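(* There exists a constant $c_0>0$ such that for all $n,r,t\in\mathbb{N}$ and $\varepsilon\in(0,1)$ with $r<\frac{\varepsilon^2 n}{c_0 t}$, there is a 1-sided error, nonadaptive, $t$-online-erasure-resilient $\varepsilon$-tester for sortedness of $n$-element real sequences $f:[n]\to\mathbb{R}$ with at most $r$ distinct values, which makes $O(\sqrt r/\varepsilon)$ queries, each chosen uniformly and independently from $[n]$.
   Context: Online-erasure model. An input is a function $f:D\to R$ on a finite domain $D$. An algorithm accesses $f$ only through an oracle $\mathcal{O}$ by querying points $x\in D$ one at a time and receiving $\mathcal{O}(x)$. Initially $\mathcal{O}(x)=f(x)$ for all $x\in D$. For $t\in\mathbb{N}$, a $t$-online-erasure oracle, after answering each query, may choose up to $t$ points $x\in D$ and set $\mathcal{O}(x)=\perp$ (a special ''erased'' symbol); these values are used to answer all future queries. The choice of erasures (the adversarial strategy) may depend on $f$, on the queries and answers so far, and on the algorithm's code, but not on the algorithm's future random coins; the algorithm does not know where erasures are. A property $\mathcal{P}$ is a set of functions; $f$ is $\varepsilon$-far from $\mathcal{P}$ if for every $g\in\mathcal{P}$, $f$ and $g$ differ on at least an $\varepsilon$ fraction of $D$. A $t$-online-erasure-resilient $\varepsilon$-tester for $\mathcal{P}$ is a randomized algorithm that, given $t,\varepsilon$ and access to $f$ via a $t$-online-erasure oracle, for every adversarial strategy accepts with probability at least $2/3$ if $f\in\mathcal{P}$ and rejects with probability at least $2/3$ if $f$ is $\varepsilon$-far from $\mathcal{P}$. It has 1-sided error if it accepts every $f\in\mathcal{P}$ with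 probability 1; it is nonadaptive if its queries do not depend on answers to previous queries. A sequence $f:[n]\to\mathbb{R}$ is sorted if $f(x)\le f(y)$ for all $x<y$; here the tester is promised that $f$ takes at most $r$ distinct values, and ''$\varepsilon$-far'' is with respect to the set of sorted sequences. *)

(* Defs.v *)
From HB Require Import structures.
From mathcomp Require Import all_boot all_order all_algebra.
From mathcomp Require Import reals.
Set Implicit Arguments. Unset Strict Implicit. Unset Printing Implicit Defensive.
Import Order.TTheory GRing.Theory Num.Theory.
Local Open Scope ring_scope.

Section OnlineErasure.
Variables (R : realType) (n : nat).

Definition sorted_fun (f : 'I_n -> R) : Prop :=
  forall x y : 'I_n, (x < y)%N -> f x <= f y.

Definition num_values (f : 'I_n -> R) : nat :=
  size (undup [seq f x | x <- enum 'I_n]).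

Definition eps_far (eps : R) (f : 'I_n -> R) : Prop :=
  forall g : 'I_n -> R, sorted_fun g ->
    eps * n%:R <= #|[set x : 'I_n | f x != g x]|%:R.

(* A nonadaptive tester whose q queries are drawn uniformly and independently
   from [n]: the query vector is a uniform element of 'I_n ^ q, and the
   decision depends on the query points and the oracle answers
   (None stands for the erased symbol ⊥). *)
Record unif_tester := UnifTester {
  tq : nat;
  tdec : tq.-tuple 'I_n -> tq.-tuple (option R) -> bool }.

(* An adversarial strategy: after each query, given the queries so far
   (the answers so far are determined by f, which is fixed before the
   strategy), it chooses a set of points to erase. *)
Definition adversary := seq 'I_n -> {set 'I_n}.

Definition adv_ok (t : nat) (adv : adversary) : Prop :=
  forall s, (#|adv s| <= t)%N.

(* points erased before the i-th query (0-indexed): erasures made after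
   each of the queries 0, ..., i-1 *)
Definition erased (adv : adversary) (qs : seq 'I_n) (i : nat) : {set 'I_n} :=
  \bigcup_(j < i) adv (take j.+1 qs).

Definition answers (q : nat) (f : 'I_n -> R) (adv : adversary)
    (qs : q.-tuple 'I_n) : q.-tuple (option R) :=
  [tuple (if tnth qs i \in erased adv qs i then None else Some (f (tnth qs i)))
  | i < q].

Definition accept_prob (T : unif_tester) (f : 'I_n -> R) (adv : adversary) : R :=
  #|[set qs : (tq T).-tuple 'I_n | tdec qs (answers f adv qs)]|%:R
    / (n ^ tq T)%:R.

End OnlineErasure.

(* Main.v *)
(** The tester rejects when two of its non-erased samples form a violation.

    Erasures are harmless: before the [i]-th query at most [i * t] points are
    erased, so some query hits an erased point with probability at most
    [q ^ 2 * t / n], which the hypothesis on [r] makes a small constant.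

    If [f] is [eps]-far, a maximal matching of violations [(x, p x)] has at
    least [eps * n / 2] edges.  For each value of [f], cutting the edges whose
    left end takes this value at a median position of these left ends yields
    a set [L] to the left of the cut and a set [U] to its right, each
    containing at least half of the corresponding ends, such that every pair in
    [L * U] is a violation.  So there are at most [r] disjoint pairs [(L, U)].
    Let [m] be about [sqrt r] and discard the classes with fewer than
    [eps * n / (4 * m ^ 2)] edges.  If [c] is the number of remaining classes
    whose [L] has been hit, the expectation of [2 * m - min m c], restricted to
    runs where no violation has been seen, shrinks by a factor
    [1 - eps / (32 * m)] at each query; as this quantity stays between [m] and
    [2 * m], [O (m / eps)] queries suffice. *)

Require Import Defs.
From HB Require Import structures.
From mathcomp Require Import all_boot all_order all_algebra.
From mathcomp Require Import reals zify ring lra.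
Set Implicit Arguments. Unset Strict Implicit. Unset Printing Implicit Defensive.
Import Order.TTheory GRing.Theory Num.Theory.
Local Open Scope ring_scope.

(** * Sums over tuples and disjoint unions *)

(** Splitting off the last query lets inductions on the number of queries condition on the earlier
    ones. *)
Lemma big_tuple_rcons (S : Type) (idx : S) (op : Monoid.com_law idx)
    (T : finType) (q : nat) (F : seq T -> S) :
  \big[op/idx]_(s : q.+1.-tuple T) F s =
  \big[op/idx]_(s : q.-tuple T) \big[op/idx]_(x : T) F (rcons s x).
Proof.
pose h (p : q.-tuple T * T) := [tuple of rcons p.1 p.2].
have h_inj : injective h.
  move=> [s x] [s' x'] /(congr1 val) /= /rcons_inj [ess' ->].
  by congr (_, _); apply: val_inj.
have h_bij : bijective h.
  by apply: (inj_card_bij h_inj); rewrite card_prod !card_tuple expnSr.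
by rewrite (reindex h) /=; [rewrite pair_big | exact: onW_bij].
Qed.

Lemma card_bigcup_disjoint (T I : finType) (A : {set I}) (F : I -> {set T}) :
  (forall i j, i != j -> [disjoint F i & F j]) ->
  #|\bigcup_(i in A) F i| = (\sum_(i in A) #|F i|)%N.
Proof.
move=> dF; pose G i := if i \in A then F i else set0.
have -> : \bigcup_(i in A) F i = \bigcup_i G i.
  by rewrite big_mkcond.
rewrite -sum1_card partition_disjoint_bigcup => [|i j ij]; last first.
  rewrite /G; case: ifP => _; last by rewrite disjoints_subset sub0set.
  case: ifP => _; last by rewrite disjoint_sym disjoints_subset sub0set.
  exact: dF.
rewrite [RHS]big_mkcond; apply: eq_bigr => i _; rewrite sum1_card /G.
by case: ifP => // _; rewrite cards0.
Qed.

(** * Probability of querying an erased point *)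

Section ErasedQueries.
Variables (n : nat) (x0 : 'I_n) (t : nat) (adv : adversary n).
Hypothesis advP : adv_ok t adv.

Definition hits_erased (s : seq 'I_n) : bool :=
  has (fun i => nth x0 s i \in erased adv s i) (iota 0 (size s)).

Lemma card_erased s i : (#|erased adv s i| <= i * t)%N.
Proof.
rewrite /erased; apply: leq_trans (_ : \sum_(j < i) t <= _)%N.
  elim/big_rec2: _ => [|j k A _ IH]; first by rewrite cards0.
  by apply: leq_trans (leq_card_setU _ _) _; rewrite leq_add.
by rewrite sum_nat_const card_ord.
Qed.

Lemma erased_rcons s x i : (i <= size s)%N ->
  erased adv (rcons s x) i = erased adv s i.
Proof.
move=> ile; apply: eq_bigr => j _; rewrite -cats1 takel_cat //.
exact: leq_trans (ltn_ord j) ile.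
Qed.

Lemma hits_erased_rcons s x :
  hits_erased (rcons s x) = hits_erased s || (x \in erased adv s (size s)).
Proof.
rewrite /hits_erased size_rcons -addn1 iotaD has_cat /= orbF add0n.
rewrite nth_rcons ltnn eqxx erased_rcons //; congr (_ || _).
apply: eq_in_has => i; rewrite mem_iota add0n => /andP[_ ilt].
by rewrite nth_rcons ilt erased_rcons // ltnW.
Qed.

(** Union bound: given the past, query [i] is uniform and at most [i * t] points are erased; the sum
    of [i] below [q] is at most [q ^ 2]. The factor [n] clears the denominator. *)
Lemma sum_hits_erased (q : nat) :
  (n * \sum_(s : q.-tuple 'I_n) hits_erased s <= q ^ 2 * t * n ^ q)%N.
Proof.
elim: q => [|q IH].
  rewrite big1 ?muln0 // => s _; by rewrite tuple0.
rewrite (big_tuple_rcons _ _ (fun s => hits_erased s : nat)).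
apply: leq_trans (_ : n * \sum_(s : q.-tuple 'I_n)
    (n * hits_erased s + q * t) <= _)%N.
  rewrite leq_mul2l; apply/orP; right; apply: leq_sum => s _.
  apply: leq_trans (_ : \sum_(x : 'I_n)
      (hits_erased s + (x \in erased adv s q)) <= _)%N.
    apply: leq_sum => x _; rewrite hits_erased_rcons size_tuple.
    by case: (hits_erased s); case: (_ \in _).
  rewrite big_split /= sum_nat_const card_ord leq_add2l.
  apply: leq_trans (card_erased s q); rewrite -sum1_card.
  by rewrite [leqRHS]big_mkcond; apply: leq_sum => x _; case: (_ \in _).
rewrite big_split /= -big_distrr /= sum_nat_const card_tuple card_ord (expnS n).
rewrite mulnDr.
apply: leq_trans (leq_add (leq_mul (leqnn n) IH) (leqnn _)) _.
rewrite (_ : _ + _ = (q ^ 2 + q) * t * (n * n ^ q))%N; last by ring.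
by rewrite !leq_mul2r; apply/orP; right; apply/orP; right; nia.
Qed.

End ErasedQueries.

(** * Potential argument on disjoint bicliques of violations *)

Section Bicliques.
Variables (R : realFieldType) (V I : finType) (viol : rel V).
Variables (L U : I -> {set V}) (k : I -> nat) (m : nat) (eps : R).
Local Notation n := #|V|.

Hypothesis violLU : forall i x y, x \in L i -> y \in U i -> viol x y.
Hypothesis disjL : forall i j, i != j -> [disjoint L i & L j].
Hypothesis disjU : forall i j, i != j -> [disjoint U i & U j].
Hypothesis kL : forall i, (k i <= 2 * #|L i|)%N.
Hypothesis kU : forall i, (k i <= 2 * #|U i|)%N.
Hypothesis m_gt0 : (0 < m)%N.
Hypothesis cardI : (#|I| <= m ^ 2)%N.
Hypothesis eps_gt0 : 0 < eps.
Hypothesis eps_lt1 : eps < 1.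
Hypothesis sum_k : eps * n%:R <= 2 * (\sum_i k i)%:R.

Definition big_class i : bool := eps * n%:R <= 4 * m%:R ^+ 2 * (k i)%:R.

Definition hit_classes (s : seq V) : {set I} :=
  [set i | big_class i & has (mem (L i)) s].

Definition undetected (s : seq V) : bool :=
  all (fun x => all (fun y => ~~ viol x y) s) s.

Definition potential (s : seq V) : nat := 2 * m - minn m #|hit_classes s|.

(** Once a query lies in [L i], any later query in [U i] completes a violation. *)
Lemma undetected_rcons s x : undetected (rcons s x) ->
  undetected s && (x \notin \bigcup_(i in hit_classes s) U i).
Proof.
rewrite /undetected => /allP und; apply/andP; split.
  apply/allP => y ys; apply/allP => z zs.
  have /und/allP : y \in rcons s x by rewrite mem_rcons inE ys orbT.
  by apply; rewrite mem_rcons inE zs orbT.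
apply/negP => /bigcupP[i]; rewrite inE => /andP[_ /hasP[z zs zL]] xU.
have /und/allP : z \in rcons s x by rewrite mem_rcons inE zs orbT.
move/(_ x); rewrite mem_rcons inE eqxx => /(_ isT) /negP; apply.
exact: violLU zL xU.
Qed.

Lemma hit_classes_rcons s x : hit_classes s \subset hit_classes (rcons s x).
Proof.
by apply/subsetP => i; rewrite !inE has_rcons => /andP[-> ->]; rewrite orbT.
Qed.

Lemma potential_rcons s x : (potential (rcons s x) <= potential s)%N.
Proof.
by have := subset_leq_card (hit_classes_rcons s x); rewrite /potential; lia.
Qed.

Definition fresh (s : seq V) : {set I} := [set i | big_class i] :\: hit_classes s.

Lemma potential_fresh s x : (#|hit_classes s| < m)%N ->
  x \in \bigcup_(i in fresh s) L i ->
  (potential (rcons s x) < potential s)%N.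
Proof.
move=> lt_m /bigcupP[i]; rewrite !inE => /andP[nhit bigi] xL.
have : hit_classes s \proper hit_classes (rcons s x).
  rewrite properE hit_classes_rcons; apply/negP => /subsetP/(_ i).
  rewrite !inE has_rcons bigi /=.
  by move: nhit; rewrite bigi /= xL => /negPf -> /(_ isT).
by move/proper_card; rewrite /potential; lia.
Qed.

(** At most [m ^ 2] classes are discarded, each with fewer than [eps * n / (4 * m ^ 2)] edges; they
    cost at most [eps * n / 4] out of at least [eps * n / 2] edges. *)
Lemma sum_big_class : eps * n%:R <= 4 * (\sum_(i | big_class i) k i)%:R.
Proof.
have m2_gt0 : 0 < m%:R ^+ 2 :> R by rewrite exprn_gt0 // ltr0n.
have small : 4 * (\sum_(i | ~~ big_class i) k i)%:R <= eps * n%:R.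
  rewrite -(ler_pM2l m2_gt0) natr_sum mulrA mulr_sumr.
  apply: le_trans (_ : \sum_(i | ~~ big_class i) eps * n%:R <= _).
    apply: ler_sum => i; rewrite /big_class -ltNge => /ltW; apply: le_trans.
    by rewrite [m%:R ^+ 2 * 4]mulrC.
  rewrite sumr_const -[X in X <= _]mulr_natl ler_wpM2r //.
    by rewrite mulr_ge0 ?ler0n // ltW.
  rewrite -natrX ler_nat; apply: leq_trans cardI; exact: max_card.
move: sum_k; rewrite (bigID big_class) /= natrD; lra.
Qed.

Lemma card_hit_U s :
  (\sum_(i in hit_classes s) k i <= 2 * #|\bigcup_(i in hit_classes s) U i|)%N.
Proof.
by rewrite card_bigcup_disjoint // big_distrr /=; apply: leq_sum => i _.
Qed.

Lemma card_fresh_L s :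
  (\sum_(i in fresh s) k i <= 2 * #|\bigcup_(i in fresh s) L i|)%N.
Proof.
by rewrite card_bigcup_disjoint // big_distrr /=; apply: leq_sum => i _.
Qed.

Lemma sum_fresh s : (\sum_(i | big_class i) k i =
  \sum_(i in hit_classes s) k i + \sum_(i in fresh s) k i)%N.
Proof.
rewrite (bigID (mem (hit_classes s))) /=; congr (_ + _)%N; apply: eq_bigl => i.
  by rewrite inE andbA andbb.
by rewrite !inE andbC.
Qed.

(* Either many points complete a violation with [s], because the hit classes
   are heavy or because there are at least [m] of them, or an [eps / 16] fraction
   of the points hits a new class. *)
Lemma potential_dichotomy s :
  eps * n%:R <= 16 * m%:R * #|\bigcup_(i in hit_classes s) U i|%:R \/
  (#|hit_classes s| < m)%N /\
    eps * n%:R <= 16 * #|\bigcup_(i in fresh s) L i|%:R.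
Proof.
have m_ge1 : 1 <= m%:R :> R by rewrite ler1n.
have kh := card_hit_U s; have kf := card_fresh_L s.
have := sum_big_class; rewrite (sum_fresh s) natrD => tot.
rewrite -(ler_nat R) natrM in kh; rewrite -(ler_nat R) natrM in kf.
have [mh|mh] := leqP m #|hit_classes s|.
  (* [m] big classes hold at least [eps * n / (4 * m)] edges, and the sets [U] keep half of them. *)
  left; set A := \sum_(i in hit_classes s) k i in kh tot.
  have : m%:R * (eps * n%:R) <= 4 * m%:R ^+ 2 * A%:R.
    rewrite /A natr_sum mulr_sumr.
    apply: le_trans (_ : \sum_(i in hit_classes s) eps * n%:R <= _).
      rewrite sumr_const -[X in _ <= X]mulr_natl ler_wpM2r ?ler_nat //.
      by rewrite mulr_ge0 ?ler0n // ltW.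
    by apply: ler_sum => i; rewrite inE => /andP[].
  have -> : 4 * m%:R ^+ 2 * A%:R = m%:R * (4 * m%:R * A%:R) :> R by lra.
  rewrite ler_pM2l; last lra.
  set u := #|_|%:R in kh *; move=> hA.
  have : m%:R * A%:R <= m%:R * (2 * u) by rewrite ler_wpM2l //; lra.
  have : 0 <= m%:R * u by rewrite mulr_ge0 // ler0n.
  lra.
set a := (\sum_(i in hit_classes s) k i)%:R in kh tot.
set b := (\sum_(i in fresh s) k i)%:R in kf tot.
set u := #|\bigcup_(i in hit_classes s) U i|%:R in kh *.
set v := #|\bigcup_(i in fresh s) L i|%:R in kf *.
(* The big classes total at least [eps * n / 4] edges, so the hit or the fresh ones have at least
   half of that. *)
have [heavy|light] := leP (eps * n%:R) (8 * a); last by right; split=> //; lra.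
left.
have : u <= m%:R * u by rewrite ler_peMl // ler0n.
lra.
Qed.

(** Either the run is detected with probability at least [eps / (16 * m)], or the potential drops by
    1 with probability at least [eps / 16]. As it is at most [2 * m], the latter is a relative loss
    of [eps / (32 * m)]. *)
Lemma potential_step s :
  \sum_(x : V) (undetected (rcons s x) * potential (rcons s x))%:R <=
  (1 - eps / (32 * m%:R)) * (n%:R * (undetected s * potential s)%:R) :> R.
Proof.
have m_ge1 : 1 <= m%:R :> R by rewrite ler1n.
have [unds|detected] := boolP (undetected s); last first.
  rewrite mul0n mulr0 mulr0 big1 // => x _.
  case: (boolP (undetected (rcons s x))) => // /undetected_rcons.
  by rewrite (negPf detected).
rewrite mul1n; set w := potential s.
have w_ge : m%:R <= w%:R :> R by rewrite ler_nat /w /potential; lia.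
have w_le : w%:R <= 2 * m%:R :> R by rewrite -natrM ler_nat /w /potential; lia.
set N := \bigcup_(i in hit_classes s) U i.
set F := \bigcup_(i in fresh s) L i.
pose d := eps / (32 * m%:R).
have dE : d * (32 * m%:R) = eps by rewrite /d divfK // lt0r_neq0; lra.
have d_ge0 : 0 <= d by rewrite divr_ge0 ?mulr_ge0 ?ler0n ?ltW.
rewrite -/d; case: (potential_dichotomy s) => [bigN|[lt_m bigF]].
  rewrite -/N in bigN.
  apply: le_trans (_ : \sum_(x : V) (x \notin N)%:R * w%:R <= _).
    apply: ler_sum => x _; rewrite -natrM ler_nat.
    case: (boolP (undetected (rcons s x))) => // /undetected_rcons/andP[_ ->].
    by rewrite !mul1n potential_rcons.
  rewrite -mulr_suml -natr_sum.
  have -> : (\sum_(x : V) (x \notin N) = n - #|N|)%N.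
    rewrite -(cardsC N) addKn -sum1_card [RHS]big_mkcond /=.
    by apply: eq_bigr => x _; rewrite inE; case: (_ \in _).
  rewrite natrB ?max_card // [X in _ <= X]mulrA ler_wpM2r ?ler0n //.
  have : m%:R * (32 * (d * n%:R)) <= m%:R * (16 * #|N|%:R).
    by move: bigN; rewrite -dE; lra.
  rewrite ler_pM2l; last lra.
  have : 0 <= d * n%:R by rewrite mulr_ge0 // ler0n.
  lra.
rewrite -/F in bigF.
apply: le_trans (_ : \sum_(x : V) (w%:R - (x \in F)%:R) <= _).
  apply: ler_sum => x _; rewrite lerBrDr -natrD ler_nat.
  have := potential_rcons s x; rewrite -/w.
  case: (boolP (x \in F)) => [/(potential_fresh lt_m)|_]; rewrite -?/w;
    by case: (undetected _); lia.
rewrite sumrB sumr_const -mulr_natl -natr_sum.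
have -> : (\sum_(x : V) (x \in F) = #|F|)%N.
  rewrite -sum1_card [RHS]big_mkcond /=.
  by apply: eq_bigr => x _; case: (_ \in _).
have : d * n%:R * w%:R <= d * n%:R * (2 * m%:R).
  by rewrite ler_wpM2l // mulr_ge0 // ler0n.
move: bigF; rewrite -dE; lra.
Qed.

Lemma sum_undetected (q : nat) :
  (\sum_(s : q.-tuple V) undetected s)%:R <=
  2 * (1 - eps / (32 * m%:R)) ^+ q * n%:R ^+ q :> R.
Proof.
have m_ge1 : 1 <= m%:R :> R by rewrite ler1n.
set d := eps / (32 * m%:R).
have d_le1 : 0 <= 1 - d.
  rewrite subr_ge0 ler_pdivrMr ?mulr_gt0 ?ltr0n // mul1r.
  have m32 : 1 <= 32 * m%:R :> R by lra.
  exact: le_trans (ltW eps_lt1) m32.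
have main : (\sum_(s : q.-tuple V) undetected s * potential s)%:R <=
    (2 * m)%:R * (1 - d) ^+ q * n%:R ^+ q :> R.
  elim: q => [|q IH].
    rewrite !expr0 !mulr1 ler_nat.
    rewrite (big_pred1 [tuple]) => [|s]; last by rewrite [s]tuple0; exact/esym/eqxx.
    by rewrite /potential; case: undetected; lia.
  rewrite (big_tuple_rcons _ _ (fun s => undetected s * potential s)%N).
  apply: le_trans (_ : (1 - d) * n%:R *
     (\sum_(s : q.-tuple V) undetected s * potential s)%:R <= _).
    rewrite !natr_sum mulr_sumr; apply: ler_sum => s _.
    by rewrite natr_sum -mulrA potential_step.
  rewrite !exprS.
  have -> : (2 * m)%:R * ((1 - d) * (1 - d) ^+ q) * (n%:R * n%:R ^+ q) =
     (1 - d) * n%:R * ((2 * m)%:R * (1 - d) ^+ q * n%:R ^+ q) :> R by ring.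
  by rewrite ler_wpM2l // mulr_ge0 // ler0n.
(* The potential starts at [2 * m] and never falls below [m]: hence the factor 2. *)
rewrite -(@ler_pM2l _ m%:R); last by lra.
apply: le_trans (_ : (\sum_(s : q.-tuple V) undetected s * potential s)%:R <= _).
  rewrite -natrM ler_nat big_distrr /=; apply: leq_sum => s _.
  by case: undetected; rewrite /potential; lia.
by move: main; rewrite natrM; lra.
Qed.

End Bicliques.

(** * From a far sequence to disjoint bicliques *)

Section Violations.
Variables (R : realType) (n : nat).
Implicit Types f : 'I_n -> R.

Definition violates f : rel 'I_n := fun x y => (x < y)%N && (f y < f x).

(** The running maximum of [f] over [G] is sorted; [lo], a lower bound of [f], serves where no point
    of [G] lies to the left. *)
Lemma sorted_extension f (G : {set 'I_n}) :
  {in G &, forall x y, ~~ violates f x y} ->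
  exists2 g : 'I_n -> R, sorted_fun g & {in G, g =1 f}.
Proof.
move=> Gsorted; pose lo := - \sum_(x : 'I_n) `|f x|.
have lo_le x : lo <= f x.
  rewrite /lo lerNl (bigD1 x) //=.
  by rewrite -[X in X <= _]addr0 lerD ?sumr_ge0 // -normrN ler_norm.
exists (fun y => \big[Order.max/lo]_(x | (x \in G) && (x <= y)%N) f x).
  move=> y z yz; apply: sub_bigmax => x /andP[-> xy] /=.
  exact: leq_trans xy (ltnW yz).
move=> y yG; apply/le_anti/andP; split; last first.
  by apply: (le_bigmax_cond lo f); rewrite yG leqnn.
apply: bigmax_le => // x /andP[xG]; rewrite leq_eqVlt => /orP[/eqP/val_inj->//|xy].
by have := Gsorted x y xG yG; rewrite /violates xy /= -leNgt.
Qed.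

(* The domain and the range of the matching may overlap: only injectivity is
   needed, and a maximal such partial map still covers every violation. *)
Lemma far_matching f (eps : R) : eps_far eps f ->
  exists (D : {set 'I_n}) (p : 'I_n -> 'I_n),
    [/\ {in D &, injective p}, {in D, forall x, violates f x (p x)}
      & eps * n%:R <= 2 * #|D|%:R].
Proof.
move=> far; pose T : finType := ({set 'I_n} * {ffun 'I_n -> 'I_n})%type.
pose ok (M : T) := [forall x in M.1, violates f x (M.2 x)] &&
  [forall x in M.1, forall y in M.1, (M.2 x == M.2 y) ==> (x == y)].
have ok0 : ok (set0, [ffun x => x]).
  by apply/andP; split; apply/forall_inP => x; rewrite inE.
case: (arg_maxnP (fun M : T => #|M.1|) ok0) => -[D p] /andP[/= viol inj] max.
have p_inj : {in D &, injective p}.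
  move=> x y xD yD pxy; apply/eqP.
  by move: inj => /forall_inP/(_ x xD)/forall_inP/(_ y yD)/implyP; apply; apply/eqP.
have p_viol : {in D, forall x, violates f x (p x)} by apply/forall_inP.
exists D, p; split=> //.
pose C := D :|: p @: D.
(* By maximality no violation avoids [C], so changing [f] on [C] alone can sort it. *)
have [g g_sorted gE] : exists2 g, sorted_fun g & {in ~: C, g =1 f}.
  apply: sorted_extension => x y; rewrite !in_setC => xC yC.
  apply/negP => xy.
  have xD : x \notin D by apply: contra xC => xD; rewrite inE xD.
  have pD z : z \in D -> p z != y.
    by move=> zD; apply: contra yC => /eqP <-; rewrite inE imset_f ?orbT.
  (* Otherwise the edge [(x, y)] would enlarge the matching. *)
  pose p' := [ffun z => if z == x then y else p z].
  have /max : ok (x |: D, p').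
    apply/andP; split=> /=; apply/forall_inP => z; rewrite in_setU1 ffunE.
      by case: eqVneq => [->|_] //= /p_viol.
    move=> zD; apply/forall_inP => w; rewrite in_setU1 ffunE => wD.
    apply/implyP; move: zD wD.
    case: (eqVneq z x) => [->|_]; case: (eqVneq w x) => [->|_] //= zD wD.
    - by rewrite eq_sym (negPf (pD _ wD)).
    - by rewrite (negPf (pD _ zD)).
    - by move/eqP/(p_inj _ _ zD wD) => ->.
  by rewrite /geq /= cardsU1 xD add1n ltnn.
apply: le_trans (far g g_sorted) _; rewrite -natrM ler_nat.
apply: leq_trans (_ : #|C| <= _)%N.
  apply: subset_leq_card; apply/subsetP => x; rewrite inE; apply: contraR => xC.
  by rewrite gE // in_setC.
apply: leq_trans (leq_card_setU _ _) _.
by rewrite mul2n -addnn leq_add2l leq_imset_card.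
Qed.

(** For the least [c] with half of the left ends before it, at least half of them are at or after
    [c - 1]; since [x < p x], their right ends are at or after [c]. *)
Lemma median_split (D : {set 'I_n}) (p : 'I_n -> 'I_n) :
  {in D, forall x : 'I_n, (x < p x)%N} ->
  exists c : nat, (#|D| <= 2 * #|[set x : 'I_n in D | (x < c)%N]|)%N /\
                  (#|D| <= 2 * #|[set x in D | (c <= p x)%N]|)%N.
Proof.
move=> ltp; pose P c := (#|D| <= 2 * #|[set x : 'I_n in D | (x < c)%N]|)%N.
have exP : exists c, P c.
  exists n; rewrite /P (_ : [set _ in _ | _] = D); first by rewrite leq_pmull.
  by apply/setP => x; rewrite inE ltn_ord andbT.
case: (ex_minnP exP) => c Pc min; exists c; split=> //.
case: c Pc min => [|c] Pc min.
  apply: leq_trans Pc _; rewrite (_ : [set x : 'I_n in D | (x < 0)%N] = set0) ?cards0 //.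
  by apply/setP => x; rewrite !inE andbF.
have : ~~ P c by apply/negP => /min; rewrite ltnn.
rewrite /P -ltnNge; set A := [set x : 'I_n in D | (x < c)%N]; set B := [set _ in _ | _].
have : (#|D :\: A| <= #|B|)%N.
  apply/subset_leq_card/subsetP => x; rewrite !inE => /andP[+ xD].
  by rewrite xD /= -leqNgt => cx; apply: leq_ltn_trans cx (ltp x xD).
have : (#|A| + #|D :\: A| = #|D|)%N.
  by rewrite -(cardsID A D) (setIidPr _) //; apply/subsetP => x; rewrite inE => /andP[].
lia.
Qed.

Lemma far_sum_undetected f (eps : R) (m q : nat) :
  (0 < m)%N -> (num_values f <= m ^ 2)%N -> 0 < eps -> eps < 1 ->
  eps_far eps f ->
  (\sum_(s : q.-tuple 'I_n) undetected (violates f) s)%:R <=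
  2 * (1 - eps / (32 * m%:R)) ^+ q * n%:R ^+ q :> R.
Proof.
move=> m_gt0 rm eps_gt0 eps_lt1 /far_matching[D [p [p_inj p_viol cardD]]].
pose vals := undup [seq f x | x <- enum 'I_n].
have cls_lt x : (index (f x) vals < num_values f)%N.
  by rewrite index_mem mem_undup map_f // mem_enum.
pose cls x := Ordinal (cls_lt x).
have clsE x y : cls x = cls y -> f x = f y.
  move/(congr1 val) => /= /(congr1 (nth 0 vals)).
  by rewrite !nth_index // mem_undup map_f // mem_enum.
pose Dc i := [set x in D | cls x == i].
have /fin_all_exists[c cP] i : exists c : nat,
    (#|Dc i| <= 2 * #|[set x in Dc i | (x < c)%N]|)%N /\
    (#|Dc i| <= 2 * #|[set x in Dc i | (c <= p x)%N]|)%N.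
  by apply: median_split => x; rewrite inE => /andP[/p_viol/andP[]].
pose L i := [set x in Dc i | (x < c i)%N].
pose U i := p @: [set x in Dc i | (c i <= p x)%N].
have nE : n%:R = #|'I_n|%:R :> R by rewrite card_ord.
rewrite nE; apply: (@sum_undetected R 'I_n _ (violates f) L U
  (fun i => #|Dc i|) m eps) => //.
(* Here [x < c i <= p z], and [f (p z) < f z = f x] because [x] and [z] share a class. *)
- move=> i x y; rewrite !inE => /andP[/andP[xD /eqP xi] xc] /imsetP[z].
  rewrite !inE => /andP[/andP[zD /eqP zi] cz] ->.
  rewrite /violates (leq_trans xc cz) /= (@clsE x z) ?xi //.
  by have /andP[] := p_viol _ zD.
- move=> i j ij; rewrite -setI_eq0; apply/eqP/setP => x; rewrite !inE.
  apply: contraNF ij => /andP[/andP[/andP[_ /eqP <-] _] /andP[/andP[_ /eqP <-] _]].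
  by rewrite eqxx.
- move=> i j ij; rewrite -setI_eq0; apply/eqP/setP => y; rewrite in_set0.
  apply: contraNF ij => /setIP[/imsetP[x xi ->] /imsetP[z zj xz]].
  move: xi zj; rewrite !inE => /andP[/andP[xD /eqP <-] _] /andP[/andP[zD /eqP <-] _].
  by rewrite (p_inj _ _ xD zD xz).
- by move=> i; have [] := cP i.
- move=> i; rewrite card_in_imset; first by have [] := cP i.
  by move=> x y; rewrite !inE => /andP[/andP[xD _] _] /andP[/andP[yD _] _]; apply: p_inj.
- by rewrite card_ord.
- rewrite -nE (_ : (\sum_i #|Dc i|)%N = #|D|) //.
  rewrite -sum1_card (partition_big cls xpredT) //=.
  by apply: eq_bigr => i _; rewrite -sum1_card; apply: eq_bigl => x; rewrite inE.
Qed.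

(** * The tester and its acceptance probability *)

Definition violation_tester (q : nat) : unif_tester R n :=
  @UnifTester R n q (fun qs ans => ~~ [exists i, exists j,
    (tnth qs i < tnth qs j)%N &&
    if (tnth ans i, tnth ans j) is (Some a, Some b) then b < a else false]).

Lemma violation_tester_sorted q f adv : (0 < n)%N -> sorted_fun f ->
  accept_prob (violation_tester q) f adv = 1.
Proof.
move=> n_gt0 sf; rewrite /accept_prob (_ : [set _ | _] = setT).
  by rewrite cardsT card_tuple card_ord divff // pnatr_eq0 -lt0n expn_gt0 n_gt0.
apply/setP => qs; rewrite !inE /=; apply/existsPn => i; apply/existsPn => j.
rewrite !tnth_mktuple; case: (tnth qs i \in _); first by rewrite andbF.
case: (tnth qs j \in _); first by rewrite andbF.
by apply/negP => /andP[/sf]; rewrite leNgt => /negPf ->.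
Qed.

(** If no query hits an erased point, all answers are true values of [f], so any sampled violation
    is seen. *)
Lemma violation_tester_accept x0 q f adv (qs : q.-tuple 'I_n) :
  @tdec _ _ (violation_tester q) qs (answers f adv qs) ->
  undetected (violates f) qs || hits_erased x0 adv qs.
Proof.
case: (boolP (hits_erased _ _ _)) => [_|clean]; rewrite ?orbT // orbF /=.
have ansE i : tnth (answers f adv qs) i = Some (f (tnth qs i)).
  rewrite tnth_mktuple; case: ifP => // er; case/hasP: clean; exists (val i).
    by rewrite mem_iota /= add0n size_tuple ltn_ord.
  by rewrite -tnth_nth.
move/existsPn => acc; apply/allP => x /tnthP[i ->]; apply/allP => y /tnthP[j ->].
by move: (acc i) => /existsPn/(_ j); rewrite !ansE.
Qed.

Lemma violation_tester_far (q t m : nat) (eps : R) f (adv : adversary n) :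
  (0 < n)%N -> (0 < m)%N -> (num_values f <= m ^ 2)%N -> 0 < eps < 1 ->
  adv_ok t adv -> eps_far eps f ->
  accept_prob (violation_tester q) f adv <=
    2 * (1 - eps / (32 * m%:R)) ^+ q + (q ^ 2 * t)%:R / n%:R.
Proof.
move=> n_gt0 m_gt0 rm /andP[eps_gt0 eps_lt1] advP far.
have nR_gt0 : 0 < n%:R :> R by rewrite ltr0n.
pose x0 := Ordinal n_gt0.
have und := far_sum_undetected q m_gt0 rm eps_gt0 eps_lt1 far.
have := sum_hits_erased x0 advP q.
rewrite -(ler_nat R) natrM [in X in _ <= X]natrM natrX => hit.
rewrite /accept_prob natrX ler_pdivrMr ?exprn_gt0 // mulrDl.
apply: le_trans (_ : (\sum_(s : q.-tuple 'I_n)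
    (undetected (violates f) s + hits_erased x0 adv s))%:R <= _).
  rewrite ler_nat -sum1_card big_mkcond /=; apply: leq_sum => s _.
  rewrite inE; case: ifP => // /(violation_tester_accept x0).
  by case: undetected; case: hits_erased.
rewrite big_split natrD /=; apply: lerD und _.
by rewrite mulrAC ler_pdivlMr // mulrC.
Qed.

End Violations.

(** * Choice of constants *)

(** An elementary substitute for [exp (- q * d)]; the induction uses
    [(1 - d) * (1 + (k + 1) * d) <= 1 + k * d]. *)
Lemma expr_subr_le (R : realFieldType) (d : R) (q : nat) :
  0 <= d <= 1 -> (1 - d) ^+ q * (1 + q%:R * d) <= 1.
Proof.
move=> /andP[d_ge0 d_le1]; elim: q => [|q IH]; first by rewrite mul0r addr0 mulr1.
apply: le_trans IH; rewrite exprSr -mulrA ler_wpM2l ?exprn_ge0 ?subr_ge0 //.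
rewrite -natr1; set k := q%:R.
have : 0 <= (k + 1) * d ^+ 2 by rewrite mulr_ge0 ?exprn_ge0 // addr_ge0 ?ler0n.
lra.
Qed.

Theorem theorem1p6 (R : realType) :
  exists c0 : R, 0 < c0 /\
  exists C : R, 0 < C /\
  forall (n r t : nat) (eps : R),
    0 < eps < 1 ->
    r%:R * c0 * t%:R < eps ^+ 2 * n%:R ->
    exists T : unif_tester R n,
      (tq T)%:R <= C * Num.sqrt r%:R / eps /\
      (forall (f : 'I_n -> R) (adv : adversary n),
          (num_values f <= r)%N -> adv_ok t adv -> sorted_fun f ->
          accept_prob T f adv = 1) /\
      (forall (f : 'I_n -> R) (adv : adversary n),
          (num_values f <= r)%N -> adv_ok t adv -> eps_far eps f ->
          accept_prob T f adv <= 1 / 3).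
Proof.
(* For [r > 0], [q <= 384 * m / eps + 1] and [m <= 2 * sqrt r] give [q <= 769 * sqrt r / eps]. The
   value [6 * C ^ 2] for [c0] then makes [q ^ 2 * t / n] at most 1/6. *)
pose C : R := 770.
have C_gt0 : 0 < C by rewrite /C; lra.
exists (6 * C ^+ 2); split; first by rewrite mulr_gt0 ?exprn_gt0.
exists C; split=> // n r t eps eps01 hn.
have /andP[eps_gt0 eps_lt1] := eps01.
have n_gt0 : (0 < n)%N.
  rewrite lt0n; apply: contraTneq hn => ->; rewrite mulr0 -leNgt.
  by rewrite !mulr_ge0 ?ler0n ?exprn_ge0 // ltW.
(* For [r = 0] the query bound forces zero queries, but no [f] on a nonempty domain has zero
   values. *)
have [r0|r_gt0] := posnP r.
  exists (violation_tester R n 0).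
  rewrite r0 sqrtr0 mulr0 mul0r; split=> //.
  have no_f (f : 'I_n -> R) : ~ (num_values f <= 0)%N.
    rewrite leqn0 size_eq0 => /eqP vals0.
    have : f (Ordinal n_gt0) \in undup [seq f x | x <- enum 'I_n].
      by rewrite mem_undup map_f // mem_enum.
    by rewrite vals0.
  by split=> f adv /no_f.
pose sr : R := Num.sqrt r%:R.
have sr2 : sr ^+ 2 = r%:R by rewrite sqr_sqrtr ?ler0n.
have sr_ge1 : 1 <= sr by rewrite -sqrtr1 ler_sqrt ?ler1n // ltr0n.
pose m := (Num.truncn sr).+1.
have /andP[m_le m_gt] : (Num.truncn sr)%:R <= sr < m%:R.
  by apply: truncn_itv; lra.
have mE : m%:R = (Num.truncn sr)%:R + 1 :> R by rewrite natr1.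
have m_le2 : m%:R <= 2 * sr by lra.
have rm : (r <= m ^ 2)%N.
  by rewrite -(ler_nat R) natrX -sr2 lerXn2r ?nnegrE ?ler0n ?ltW //; lra.
have m_ge1 : 1 <= m%:R :> R by rewrite ler1n.
(* [384 = 12 * 32], so that [q * d >= 12] for [d = eps / (32 * m)]. *)
pose a : R := 384 * m%:R / eps.
have aE : a * eps = 384 * m%:R by rewrite divfK // gt_eqF.
have a_ge0 : 0 <= a by rewrite divr_ge0 ?mulr_ge0 ?ler0n // ltW.
pose q := (Num.truncn a).+1.
have /andP[q_le q_gt] : (Num.truncn a)%:R <= a < q%:R by apply: truncn_itv.
have q_leC : q%:R <= C * sr / eps.
  have qE : q%:R = (Num.truncn a)%:R + 1 :> R by rewrite natr1.
  rewrite ler_pdivlMr // qE.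
  have : (Num.truncn a)%:R * eps <= a * eps by rewrite ler_wpM2r // ltW.
  rewrite aE /C; lra.
exists (violation_tester R n q); split=> //; split=> f adv vr advP fP.
  exact: violation_tester_sorted.
have vm := leq_trans vr rm.
apply: le_trans (violation_tester_far q n_gt0 (ltn0Sn _) vm eps01 advP fP) _.
rewrite -/m; set d := eps / (32 * m%:R).
have m32_gt0 : 0 < 32 * m%:R :> R by lra.
have dE : d * (32 * m%:R) = eps by rewrite divfK // gt_eqF.
have d_ge0 : 0 <= d by rewrite divr_ge0 ?ltW.
have d_le1 : d <= 1 by rewrite ler_pdivrMr // mul1r; lra.
have qd : 12 <= q%:R * d.
  have ad : a * d = 12.
    rewrite /a /d; field; apply/andP; split; apply: lt0r_neq0; lra.
  by rewrite -ad ler_wpM2r // ltW.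
have := @expr_subr_le _ d q; rewrite d_ge0 d_le1 => /(_ isT) bern.
have e_ge0 : 0 <= (1 - d) ^+ q by rewrite exprn_ge0 // subr_ge0.
have e_le : (1 - d) ^+ q * 12 <= (1 - d) ^+ q * (q%:R * d) by rewrite ler_wpM2l.
have er : (q ^ 2 * t)%:R / n%:R <= 1 / 6 :> R.
  have nR_gt0 : 0 < n%:R :> R by rewrite ltr0n.
  rewrite ler_pdivrMr // natrM natrX.
  have eps2_gt0 : 0 < eps ^+ 2 by rewrite exprn_gt0.
  have qe : q%:R * eps <= C * sr by rewrite -ler_pdivlMr.
  have qe2 : (q%:R * eps) ^+ 2 <= (C * sr) ^+ 2.
    have q_ge0 : 0 <= q%:R * eps by rewrite mulr_ge0 ?ler0n ?ltW.
    by rewrite lerXn2r // nnegrE (le_trans q_ge0).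
  rewrite -(ler_pM2l eps2_gt0).
  have : (q%:R * eps) ^+ 2 * t%:R <= (C * sr) ^+ 2 * t%:R.
    by rewrite ler_wpM2r ?ler0n.
  rewrite !exprMn sr2; move: hn; lra.
(* The undetected runs contribute at most 2/13 and the erasures at most 1/6. *)
lra.
Qed.
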